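(* Let $k\geq 1$ be an integer. Then all positive integer solutions $(x,y)$ of the equation $x^{2}-(k^{2}+1)y^{2}=-1$ are given by $$(x,y)=\left(\frac{V_{2n-1}(2k,1)}{2},U_{2n-1}(2k,1)\right)$$ with $n\geq 1$. That is, the set of pairs of positive integers solving the equation is exactly the set of these pairs as $n$ ranges over the integers $n\ge 1$.
   Context: For nonzero integers $m,s$ with $m^{2}+4s>0$, the generalized Fibonacci sequence is defined by $U_{0}(m,s)=0$, $U_{1}(m,s)=1$, $U_{n+1}(m,s)=mU_{n}(m,s)+sU_{n-1}(m,s)$ for $n\ge 1$, and the generalized Lucas sequence by $V_{0}(m,s)=2$, $V_{1}(m,s)=m$, $V_{n+1}(m,s)=mV_{n}(m,s)+sV_{n-1}(m,s)$ for $n\ge 1$. *)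

(* Defs.v *)
From mathcomp Require Import all_boot all_order all_algebra.

Set Implicit Arguments.
Unset Strict Implicit.
Unset Printing Implicit Defensive.

Import Order.TTheory GRing.Theory Num.Theory.
Local Open Scope ring_scope.

(* Both sequences are defined for all integers m and s; the usual conditions  *)
(* m != 0, s != 0 and m ^+ 2 + 4 * s > 0 are not needed for the recurrences   *)
(* and hold for the parameters (2 * k, 1) with k >= 1.                        *)

Fixpoint gen_fib (m s : int) (n : nat) : int :=
  match n with
  | 0 => 0
  | 1 => 1
  | (n'.+1 as n1).+1 => m * gen_fib m s n1 + s * gen_fib m s n'
  end.

Fixpoint gen_lucas (m s : int) (n : nat) : int :=
  match n with
  | 0 => 2
  | 1 => m
  | (n'.+1 as n1).+1 => m * gen_lucas m s n1 + s * gen_lucas m s n'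
  end.

(* Main.v *)
Require Import Defs.
From mathcomp Require Import all_boot all_order all_algebra.
From mathcomp Require Import ring zify.

Import Order.TTheory GRing.Theory Num.Theory.
Local Open Scope ring_scope.

(** Put [d = k ^ 2 + 1].  The number [eps = k + sqrt d] has norm
    [k ^ 2 - d = -1], and its powers are [eps ^ n = V_n / 2 + U_n * sqrt d],
    where [U] and [V] are the sequences with parameters [(2 * k, 1)]
    (lemma [gen_lucas_fibS]).  Taking norms gives
    [(V_n / 2) ^ 2 - d * U_n ^ 2 = (-1) ^ n] (lemma [gen_lucas_fib_norm]), so
    the odd powers of [eps] solve the equation of norm [-1].

    Conversely, [eps] generates all the units [x + y * sqrt d] with [x > 0] and
    [y >= 0] (lemma [unit_is_power]).  Dividing such a unit by [eps] amounts to
    multiplying it by [- k + sqrt d]; this flips the sign of the norm, keeps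
    the signs of the coordinates, and strictly decreases [y] as long as
    [y > 0].  The descent stops at [y = 0], that is, at the unit [1 = eps ^ 0].
    It has to run through both norms [1] and [-1], since each step flips the
    norm; the norm then determines the parity of the exponent. *)

(** Both recurrences unfold to multiplication by [k + sqrt d]. The factors [2]
    avoid halving [V_n] in the integers. *)
Lemma gen_lucas_fibS (k : int) (n : nat) :
  gen_lucas (2 * k) 1 n.+1
    = k * gen_lucas (2 * k) 1 n + 2 * (k ^+ 2 + 1) * gen_fib (2 * k) 1 n /\
  2 * gen_fib (2 * k) 1 n.+1
    = gen_lucas (2 * k) 1 n + 2 * k * gen_fib (2 * k) 1 n.
Proof.
elim: n => [|n [IHV IHU]]; first by split=> /=; ring.
have -> : gen_lucas (2 * k) 1 n.+2
  = 2 * k * gen_lucas (2 * k) 1 n.+1 + 1 * gen_lucas (2 * k) 1 n by [].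
have -> : gen_fib (2 * k) 1 n.+2
  = 2 * k * gen_fib (2 * k) 1 n.+1 + 1 * gen_fib (2 * k) 1 n by [].
have V_n : gen_lucas (2 * k) 1 n
  = 2 * gen_fib (2 * k) 1 n.+1 - 2 * k * gen_fib (2 * k) 1 n.
  by rewrite IHU; ring.
by rewrite IHV V_n; split; ring.
Qed.

Lemma gen_lucas_fib_norm (k : int) (n : nat) :
  gen_lucas (2 * k) 1 n ^+ 2 - 4 * (k ^+ 2 + 1) * gen_fib (2 * k) 1 n ^+ 2
    = 4 * (-1) ^+ n.
Proof.
elim: n => [|n IH]; first by rewrite /= expr0; ring.
have [-> EU] := gen_lucas_fibS k n.
have -> : 4 * (k ^+ 2 + 1) * gen_fib (2 * k) 1 n.+1 ^+ 2
  = (k ^+ 2 + 1) * (2 * gen_fib (2 * k) 1 n.+1) ^+ 2 by ring.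
by rewrite EU [in RHS]exprS [in RHS]mulrCA -IH; ring.
Qed.

Lemma gen_lucas_fib_gt0 (k : int) (n : nat) : 1 <= k ->
  0 < gen_lucas (2 * k) 1 n /\ 0 < gen_fib (2 * k) 1 n.+1.
Proof.
move=> k_ge1.
have [V_gt0 U_ge0] : 0 < gen_lucas (2 * k) 1 n /\ 0 <= gen_fib (2 * k) 1 n.
  elim: n => [//|n [IHV IHU]].
  by have [-> EU] := gen_lucas_fibS k n; split; nia.
by have [_ EU] := gen_lucas_fibS k n; split=> //; nia.
Qed.

(** One descent step: [x' + y' sqrt d] is [(x + y sqrt d) (- k + sqrt d)], the
    quotient by [eps].  Each inequality compares two positive numbers through
    their squares, whose difference is computed from the equation. *)
Lemma unit_descent (k x y e : int) : 1 <= k -> e = 1 \/ e = -1 ->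
    0 < x -> 0 < y -> x ^+ 2 - (k ^+ 2 + 1) * y ^+ 2 = e ->
  let x' := (k ^+ 2 + 1) * y - k * x in
  let y' := x - k * y in
  [/\ 0 < x', 0 <= y', y' < y & x' ^+ 2 - (k ^+ 2 + 1) * y' ^+ 2 = - e].
Proof.
move=> k_ge1 e_unit x_gt0 y_gt0 E x' y'; rewrite /x' /y'; split.
- (* [(d y) ^ 2 - (k x) ^ 2 = d y ^ 2 - k ^ 2 e > 0] *)
  by case: e_unit => e_val; nia.
- (* [x ^ 2 - (k y) ^ 2 = y ^ 2 + e >= 0] *)
  by case: e_unit => e_val; nia.
- (* [((k + 1) y) ^ 2 - x ^ 2 = 2 k y ^ 2 - e > 0] *)
  by case: e_unit => e_val; nia.
- by rewrite -E; ring.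
Qed.

(** Descent on [y]. The norm [e] varies with the unit in the induction, because
    each step changes its sign. *)
Lemma unit_is_power (k x y e : int) : 1 <= k -> e = 1 \/ e = -1 ->
    0 < x -> 0 <= y -> x ^+ 2 - (k ^+ 2 + 1) * y ^+ 2 = e ->
  exists n : nat, gen_lucas (2 * k) 1 n = 2 * x /\ gen_fib (2 * k) 1 n = y.
Proof.
move=> k_ge1.
have [b] : exists b : nat, y < b%:Z by exists `|y|%N.+1; lia.
elim: b x y e => [|b IH] x y e y_lt e_unit x_gt0 y_ge0 E; first by lia.
have [y0 | y_neq0] := eqVneq y 0.
  have x1 : x = 1 by move: E; rewrite y0; case: e_unit => ->; nia.
  by exists 0%N; rewrite x1 y0.
have y_gt0 : 0 < y by lia.
have [x'_gt0 y'_ge0 y'_lt E'] := unit_descent k x y e k_ge1 e_unit x_gt0 y_gt0 E.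
have [||n [EV EU]] := IH _ _ _ _ _ x'_gt0 y'_ge0 E'; [lia | lia |].
exists n.+1; have [-> E2U] := gen_lucas_fibS k n.
split; first by rewrite EV EU; ring.
by apply: (@mulfI _ (2 : int)); rewrite // E2U EV EU; ring.
Qed.

Theorem theorem16 (k : int) (hk : 1 <= k) (x y : rat) :
  [/\ x \is a Num.int, y \is a Num.int, 0 < x, 0 < y &
      x ^+ 2 - (k%:~R ^+ 2 + 1) * y ^+ 2 = -1]
  <->
  exists n : nat, (1 <= n)%N /\
    (x, y) = ((gen_lucas (2 * k) 1 (2 * n - 1))%:~R / 2,
              (gen_fib (2 * k) 1 (2 * n - 1))%:~R).
Proof.
split.
- case=> /intrP [a ->] /intrP [b ->]; rewrite !ltr0z => a_gt0 b_gt0 E.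
  have Eint : a ^+ 2 - (k ^+ 2 + 1) * b ^+ 2 = -1.
    by apply: (@intr_inj rat); rewrite rmorphB rmorphXn rmorphM rmorphD !rmorphXn.
  have [n [EV EU]] :=
    unit_is_power k a b (-1) hk (or_intror erefl) a_gt0 (ltW b_gt0) Eint.
  (* An even exponent would give norm [1]. *)
  have n_odd : odd n.
    have := gen_lucas_fib_norm k n; rewrite EV EU -signr_odd.
    by case: (odd n) => //; rewrite expr0 => N; nia.
  exists (n./2.+1); split=> //.
  have -> : (2 * n./2.+1 - 1)%N = n by lia.
  by rewrite EV EU intrM mulrC mulKf.
- case=> -[[] //|m [_ [-> ->]]].
  have -> : (2 * m.+1 - 1)%N = (2 * m).+1 by lia.
  set n := (2 * m).+1.
  have [V_gt0 _] := gen_lucas_fib_gt0 k n hk.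
  have [_ U_gt0] := gen_lucas_fib_gt0 k (2 * m) hk.
  have [_ E2U] := gen_lucas_fibS k n.
  (* [V_n] is even because [V_n = 2 U_{n+1} - 2 k U_n]. *)
  have [a EV] : exists a, gen_lucas (2 * k) 1 n = 2 * a.
    exists (gen_fib (2 * k) 1 n.+1 - k * gen_fib (2 * k) 1 n).
    by rewrite mulrBr E2U; ring.
  have N := gen_lucas_fib_norm k n.
  rewrite EV in V_gt0 N *.
  have -> : (2 * a)%:~R / 2 = a%:~R :> rat by rewrite intrM mulrC mulKf.
  have Eint : a ^+ 2 - (k ^+ 2 + 1) * gen_fib (2 * k) 1 n ^+ 2 = -1.
    have sgn : (-1) ^+ n = -1 :> int by rewrite -signr_odd /n mul2n /= odd_double.
    rewrite sgn in N; apply: (@mulfI _ (4 : int)) => //.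
    by rewrite -N; ring.
  split; rewrite ?intr_int ?ltr0z //; first by lia.
  have /(congr1 (intr : int -> rat)) := Eint.
  by rewrite rmorphB rmorphXn rmorphM rmorphD !rmorphXn.
Qed.
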